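(* A connected graph $G$ is a smooth graph if and only if the set $U(v,u)=\{x\in V(G): v\in I[x,u]\}$ is geodesically convex for any two adjacent vertices $u,v$ of $G$.
   Context: Graphs are simple and undirected; $d$ denotes the shortest path distance of a connected graph $G$. Intervals: $I[u,v]=\{w\in V(G): d(u,w)+d(w,v)=d(u,v)\}$; $N(u)=\{w: d(u,w)=1\}$; the step system (step function) of $G$ is $S(u,v)=I[u,v]\cap N(u)$. A connected graph $G$ is smooth if for all vertices $u,v,w,x,y$: $v\in S(u,w)$, $v\in S(u,y)$ and $x\in S(w,y)$ imply $v\in S(u,x)$. A set $A\subseteq V(G)$ is geodesically convex if $I[a,b]\subseteq A$ for all $a,b\in A$. *)

(* Defs.v *)
From mathcomp Require Import all_boot.
From mathcomp Require Import boolp classical_sets.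

Set Implicit Arguments.
Unset Strict Implicit.
Unset Printing Implicit Defensive.

Local Open Scope classical_set_scope.

(* The vertex type is arbitrary: infinite graphs are included. *)
Record graph := Graph {
  vertex :> Type;
  adj : rel vertex;
  adj_sym : symmetric adj;
  adj_irrefl : irreflexive adj
}.

Section Graph.
Variable G : graph.
Implicit Types (u v w x y a b : G) (A : set G).

Definition walk u v (n : nat) : Prop :=
  exists p : seq G, [/\ path (@adj G) u p, last u p = v & size p = n].

Definition connected : Prop := forall u v, exists n, walk u v n.

(* A walk of minimal length is a shortest path. The value 0 for vertices not   *)
(* joined by any walk is junk, never reached in a connected graph.             *)
Definition dist u v : nat :=
  if pselect (exists n, `[< walk u v n >]) is left uv then ex_minn uv else 0.

Definition interval u v : set G := [set w | dist u w + dist w v = dist u v].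

Definition nbhd u : set G := [set w | dist u w = 1].

Definition step u v : set G := interval u v `&` nbhd u.

Definition smooth : Prop :=
  forall u v w x y, step u w v -> step u y v -> step w y x -> step u x v.

Definition geodesically_convex A : Prop :=
  forall a b, A a -> A b -> interval a b `<=` A.

Definition U v u : set G := [set x | interval x u v].

End Graph.

Arguments connected : clear implicits.
Arguments smooth : clear implicits.

(* Main.v *)
Require Import Defs.
From mathcomp Require Import all_boot.
From mathcomp Require Import boolp classical_sets.
From mathcomp Require Import zify.

(** For adjacent [u] and [v], [x] lies in [U v u] exactly when [v] lies in
    [step u x] (lemma [U_step]). Smoothness thus says that when [w] and [y] are
    in some [U v u], so is every first vertex [x] of a geodesic from [w] to [y].
    Convexity asks the same for every vertex of such a geodesic. It therefore
    implies smoothness at once. Conversely, the set is reached from [w] to any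
    vertex [z] of [interval w y] by moving one edge at a time: the first vertex
    [x] of a geodesic from [w] to [z] is in [step w y], hence in [U v u], and
    [z] is in [interval x y] and closer to [x] than to [w]. The induction is on
    the distance from [w] to [z]; the lemma [first_step] provides [x]. *)

Set Implicit Arguments.
Unset Strict Implicit.
Unset Printing Implicit Defensive.

Section Distance.
Variables (G : graph) (G_connected : connected G).
Implicit Types u v w x y z : G.

Lemma dist_walk u v : walk u v (dist u v).
Proof.
rewrite /dist; case: pselect => [uv|no_walk].
  by case: ex_minnP => n /asboolP.
by have [n uvn] := G_connected u v; case: no_walk; exists n; apply/asboolP.
Qed.

Lemma dist_min u v n : walk u v n -> dist u v <= n.
Proof.
move=> uvn; rewrite /dist; case: pselect => // uv.
by case: ex_minnP => m _; apply; apply/asboolP.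
Qed.

Lemma walk_sym u v n : walk u v n -> walk v u n.
Proof.
move=> [p [uvp <- <-]]; exists (rev (belast u p)); split.
- by rewrite rev_path (eq_path (fun x y => adj_sym y x)).
- by case: p uvp => //= a p _; rewrite rev_cons last_rcons.
- by rewrite size_rev size_belast.
Qed.

Lemma walk_cat u v w m n : walk u v m -> walk v w n -> walk u w (m + n).
Proof.
move=> [p [up <- <-]] [q [vq <- <-]]; exists (p ++ q).
by rewrite cat_path up vq last_cat size_cat.
Qed.

Lemma dist_sym u v : dist u v = dist v u.
Proof.
by apply/eqP; rewrite eqn_leq !dist_min //; apply/walk_sym/dist_walk.
Qed.

Lemma dist_triangle u v w : dist u w <= dist u v + dist v w.
Proof. by apply: dist_min; apply: walk_cat; apply: dist_walk. Qed.

Lemma dist_eq0 u v : dist u v = 0 -> u = v.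
Proof.
by move=> uv0; have := dist_walk u v; rewrite uv0 => -[[|a p] []].
Qed.

Lemma dist_adj u v : adj u v -> dist u v = 1.
Proof.
move=> uv; have le1 : dist u v <= 1.
  by apply: dist_min; exists [:: v]; rewrite /= uv.
have [/eqP|dist_gt0] := posnP (dist u v); last lia.
by move=> /eqP/dist_eq0 eq_uv; rewrite eq_uv adj_irrefl in uv.
Qed.

Lemma dist1_adj u v : dist u v = 1 -> adj u v.
Proof.
move=> uv1; have := dist_walk u v; rewrite uv1.
by move=> [[|a [|b p]] [//= /andP[ua _] <-]].
Qed.

(** The second vertex of a shortest walk from [w] to [z]: the rest of the walk
    bounds its distance to [z], and the triangle inequality makes this bound an
    equality. *)
Lemma first_step w z : 0 < dist w z -> exists x, step w z x.
Proof.
move=> wz_gt0; have [[|x p] [/= wp lastp sizep]] := dist_walk w z; first lia.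
case/andP: wp => wx xp; exists x; have wx1 := dist_adj wx.
have xz_le : dist x z <= size p by apply: dist_min; exists p.
have := dist_triangle w x z.
by split; rewrite /interval /nbhd /=; lia.
Qed.

Lemma U_step u v x : adj u v -> U v u x <-> step u x v.
Proof.
move=> /dist_adj uv1; rewrite /U /step /interval /nbhd /=.
rewrite (dist_sym x v) (dist_sym x u) (dist_sym v u) addnC.
by split=> [|[]].
Qed.

(** A geodesic from [w] to [z] followed by one from [z] to [y] is a geodesic
    from [w] to [y]. *)
Lemma step_interval w x y z :
  interval w y z -> step w z x -> step w y x /\ interval x y z.
Proof.
rewrite /step /interval /nbhd /= => wzy [wxz wx1].
have := dist_triangle w x y; have := dist_triangle x z y.
by split; [split|]; rewrite /=; lia.
Qed.

End Distance.

Theorem lemma9 (G : graph) (G_connected : connected G) :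
  smooth G <-> (forall u v : G, adj u v -> geodesically_convex (U v u)).
Proof.
split=> [smoothG u v uv w y Uw Uy z | convexU u v w x y].
  move: {2}(dist w z) (erefl (dist w z)) => n.
  elim: n w Uw => [|n IHn] w Uw wz wyz; first by rewrite -(dist_eq0 _ wz).
  have [x wzx] : exists x, step w z x by apply: first_step; rewrite ?wz.
  have [wyx xyz] := step_interval G_connected wyz wzx.
  apply: (IHn x) => //.
    apply/U_step => //.
    by apply: (smoothG u v w x y) => //; apply/U_step.
  by case: wzx; rewrite /interval /nbhd /= => wxz wx1; lia.
move=> uwv uyv [wyx _].
have uv : adj u v by case: uwv => _; apply: dist1_adj.
apply/U_step => //.
by apply: (convexU u v uv w y) => //; apply/U_step.
Qed.
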